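(* Let $d\ge 1$ be an integer and $\nu>0$. There exist maps $C^1_{d,\nu}$ and $C^2_{d,\nu}$, which assign to the Fourier transform $\mathcal{F}[f]$ of a function $f\in H_\nu$ numbers $C^1_{d,\nu}(\mathcal{F}[f]),\,C^2_{d,\nu}(\mathcal{F}[f])\in[0,\infty)$ and which do not depend on $h$, such that for every bandwidth $h>0$ and every $f\in H_\nu$, $$\Vert f\Vert_{H_\nu}^2\;\leq\; h^{2\nu}\left(\frac{1}{h^{2\nu+d}}\,C^1_{d,\nu}(\mathcal{F}[f])+C^2_{d,\nu}(\mathcal{F}[f])\right),$$ where $\Vert f\Vert_{H_\nu}$ is the norm of the reproducing kernel Hilbert space of the Matérn kernel with bandwidth $h$ and smoothness $\nu$.
   Context: For $d\ge1$, $\nu>0$, put $C_{d,\nu}:=\dfrac{2^d\pi^{d/2}\,\Gamma(\nu+d/2)\,(2\nu)^\nu}{\Gamma(\nu)}$. The Matérn kernel on $\mathbb{R}^d$ with smoothness $\nu>0$ and bandwidth $h>0$ is $k_\nu(x,y)=\frac{2^{1-\nu}}{\Gamma(\nu)}\left(\frac{\sqrt{2\nu}\Vert x-y\Vert}{h}\right)^\nu K_\nu\left(\frac{\sqrt{2\nu}\Vert x-y\Vert}{h}\right)$ (value $1$ at $x=y$), with $K_\nu$ the modified Bessel function of the second kind. The norm of its reproducing kernel Hilbert space $H_\nu$ is given (this is taken as the definition of the norm here) by $$\Vert f\Vert_{H_\nu}^2=h^{2\nu}\left((2\pi)^{d/2}C_{d,\nu}\right)^{-1}\int_{\mathbb{R}^d}\left(\frac{2\nu}{h^2}+\left(2\pi\Vert\omega\Vert\right)^2\right)^{\nu+d/2}|\mathcal{F}[f](\omega)|^2\,\mathrm{d}\omega,$$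 where $\mathcal{F}[f]$ denotes the Fourier transform of $f$, in the convention $\mathcal{F}[f](\omega)=\int_{\mathbb{R}^d} f(x)e^{-2\pi i\omega^\top x}\,\mathrm{d}x$ (extended to $L^2$). $H_\nu$ consists of those $f\in L^2(\mathbb{R}^d)$ for which this quantity is finite; as a set it does not depend on $h$. *)

(* Defs.v *)
From HB Require Import structures.
From mathcomp Require Import all_boot all_order all_algebra complex.
From mathcomp Require Import all_classical all_reals all_analysis.
From mathcomp Require Import measurable_realfun.

Set Implicit Arguments.
Unset Strict Implicit.
Unset Printing Implicit Defensive.
Import Order.TTheory GRing.Theory Num.Theory.
Import numFieldNormedType.Exports.

Local Open Scope classical_set_scope.
Local Open Scope ring_scope.

Section lebesgue_tuple.
Variable R : realType.

Definition tuple_cons d (p : measurableTypeR R * d.-tuple R) : d.+1.-tuple R :=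
  [tuple of p.1 :: p.2].

Lemma measurable_tuple_cons d : measurable_fun setT (@tuple_cons d).
Proof. exact: measurable_cons. Qed.

Section step.
Variables (d : nat) (mu : {sigma_finite_measure set (d.-tuple R) -> \bar R}).
Local Open Scope ereal_scope.

Definition lebesgue_tuple_step : set (d.+1.-tuple R) -> \bar R :=
  pushforward (@lebesgue_measure R \x mu) (@tuple_cons d).

Let step0 : lebesgue_tuple_step set0 = 0.
Proof. by rewrite /lebesgue_tuple_step /pushforward preimage_set0 measure0. Qed.

Let step_ge0 A : 0 <= lebesgue_tuple_step A.
Proof. by rewrite /lebesgue_tuple_step /pushforward measure_ge0. Qed.

Let mpre (A : set (d.+1.-tuple R)) :
  measurable A -> measurable (@tuple_cons d @^-1` A).
Proof.
by move=> mA; rewrite -[X in measurable X]setTI; exact: measurable_tuple_cons.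
Qed.

Let step_sigma_additive : semi_sigma_additive lebesgue_tuple_step.
Proof.
move=> F mF tF mUF; rewrite /lebesgue_tuple_step /pushforward preimage_bigcup.
apply: measure_semi_sigma_additive.
- by move=> n; exact: mpre.
- apply/trivIsetP => /= i j _ _ ij; rewrite -preimage_setI.
  by move/trivIsetP : tF => /(_ _ _ _ _ ij) ->//; rewrite preimage_set0.
- by rewrite -preimage_bigcup; exact: mpre.
Qed.

HB.instance Definition _ := isMeasure.Build _ _ _ lebesgue_tuple_step
  step0 step_ge0 step_sigma_additive.

Lemma lebesgue_tuple_stepE (A : set R) (B : set (d.-tuple R)) :
  measurable A -> measurable B ->
  lebesgue_tuple_step [set x | A (thead x) /\ B [tuple of behead x]] =
  @lebesgue_measure R A * mu B.
Proof.
move=> mA mB; rewrite -product_measure1E// /lebesgue_tuple_step /pushforward.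
have E p : [tuple of behead (@tuple_cons d p)] = p.2 by apply/val_inj.
by congr product_measure1; apply/seteqP; split=> -[x y] /=; rewrite theadE E.
Qed.

Let step_sigma_finite : sigma_finite setT lebesgue_tuple_step.
Proof.
have /sigma_finiteP[F [TF ndF Foo]] := sigma_finiteT (@lebesgue_measure R).
have /sigma_finiteP[G [TG ndG Goo]] := sigma_finiteT mu.
exists (fun n => [set x | F n (thead x) /\ G n [tuple of behead x]]).
  apply/seteqP; split=> // x _.
  have : setT (thead x) by []. rewrite TF => -[n _ Fn].
  have : setT [tuple of behead x] by []. rewrite TG => -[k _ Gk].
  exists (maxn n k) => //=; split.
    by move: Fn; apply/subsetPset/ndF/leq_maxl.
  by move: Gk; apply/subsetPset/ndG/leq_maxr.
move=> k; have [? ?] := Foo k; have [? ?] := Goo k; split; last first.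
  by rewrite lebesgue_tuple_stepE// lte_mul_pinfty// ge0_fin_numE.
apply: measurableI; rewrite -[X in measurable X]setTI.
  by apply: (@measurable_tnth _ R _ ord0).
by apply: (@measurable_behead _ R).
Qed.

HB.instance Definition _ := Measure_isSigmaFinite.Build _ _ _
  lebesgue_tuple_step step_sigma_finite.

End step.

(* Lebesgue measure on [R^d], see [lebesgue_tuple_box]. *)
Fixpoint lebesgue_tuple d : {sigma_finite_measure set (d.-tuple R) -> \bar R} :=
  match d with
  | 0 => \d_[tuple]%E
  | d'.+1 => lebesgue_tuple_step (lebesgue_tuple d')
  end.

Lemma lebesgue_tuple_box d (A : 'I_d -> set R) :
  (forall i, measurable (A i)) ->
  lebesgue_tuple d [set x | forall i, A i (tnth x i)] =
  (\prod_(i < d) @lebesgue_measure R (A i))%E.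
Proof.
elim: d A => [A _|d IH A mA].
  by rewrite big_ord0 /= diracE mem_set//= => -[].
rewrite big_ord_recl -IH// -lebesgue_tuple_stepE//; last first.
  rewrite [X in measurable X](_ : _ = \bigcap_(i in [set: 'I_d])
    ((fun x : d.-tuple R => tnth x i) @^-1` A (lift ord0 i))); last first.
    by apply/seteqP; split=> x /= Ax i => [_|]; exact: Ax.
  apply: fin_bigcap_measurable => [|i _]; first exact: finite_finset.
  by rewrite -[X in measurable X]setTI; apply: (@measurable_tnth _ R).
congr lebesgue_tuple_step; apply/seteqP; split=> x /=.
  move=> Ax; split=> [|i]; first exact: Ax.
  by have := Ax (lift ord0 i); rewrite [X in tnth X _](tuple_eta x) tnthS.
move=> [A0 Ai] i; case: (unliftP ord0 i) => [j ->|->//].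
by rewrite [X in tnth X _](tuple_eta x) tnthS; exact: Ai.
Qed.

End lebesgue_tuple.

Section complex_functions.
Context dT (T : measurableType dT) (R : realType).
Variable mu : {measure set T -> \bar R}.
Implicit Types f g : T -> R[i].

Definition cabs (z : R[i]) : R := ComplexField.Normc.normc z.

Definition cmeasurable f :=
  measurable_fun setT (fun x => complex.Re (f x)) /\
  measurable_fun setT (fun x => complex.Im (f x)).

Definition cLnorm (p : \bar R) f : \bar R :=
  ('N[mu]_p [EFin \o (fun x => cabs (f x))])%E.

Definition cLfun (p : \bar R) : set (T -> R[i]) :=
  [set f | cmeasurable f /\ (cLnorm p f < +oo)%E].

Definition cintegral f : R[i] :=
  Complex (\int[mu]_x complex.Re (f x)) (\int[mu]_x complex.Im (f x)).

Lemma measurable_cabs f : cmeasurable f ->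
  measurable_fun setT (fun x => cabs (f x)).
Proof.
move=> [mRe mIm].
rewrite (_ : (fun x => _) = fun x => Num.sqrt
    (complex.Re (f x) ^+ 2 + complex.Im (f x) ^+ 2)); last first.
  by apply/funext => x; rewrite /cabs; case: (f x).
apply: measurableT_comp; first by
  apply: continuous_measurable_fun; exact: sqrt_continuous.
by apply: measurable_funD; exact: measurable_funX.
Qed.

Lemma ae_eq_cLnorm2 f g : cmeasurable f -> cmeasurable g ->
  {ae mu, forall x, f x = g x} -> cLnorm 2%:E f = cLnorm 2%:E g.
Proof.
move=> /measurable_cabs mf /measurable_cabs mg fg; rewrite /cLnorm unlock /Lnorm.
congr (_ `^ _)%E; apply: ae_eq_integral => //.
1,2: apply: (@measurableT_comp _ _ _ _ _ _ (poweR^~ 2%R));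
  [exact: measurable_poweR|apply: measurableT_comp => //; exact/measurable_EFinP].
by apply: filterS fg => x /= -> _.
Qed.

Lemma cmeasurableB f g : cmeasurable f -> cmeasurable g ->
  cmeasurable (fun x => f x - g x).
Proof.
move=> [fRe fIm] [gRe gIm]; split.
  under eq_fun do rewrite raddfB.
  exact: measurable_funB.
under eq_fun do rewrite raddfB.
exact: measurable_funB.
Qed.

End complex_functions.

Section fourier.
Variables (R : realType) (d : nat).
Local Notation mu := (lebesgue_tuple R d).
Implicit Types f g : d.-tuple R -> R[i].

Definition dotp (x y : d.-tuple R) : R := \sum_(i < d) tnth x i * tnth y i.

Definition enorm (x : d.-tuple R) : R := Num.sqrt (dotp x x).

(* exp (i t) *)
Definition cis (t : R) : R[i] := Complex (cos t) (sin t).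

Definition fourierL1 f (w : d.-tuple R) : R[i] :=
  cintegral mu (fun x => f x * cis (- (2 * pi * dotp w x))).

(* [g] is a representative of the value at [f] of the continuous extension to
   [L^2] of the Fourier transform of [L^1 `&` L^2]. *)
Definition is_fourierL2 f g :=
  cLfun mu 2%:E g /\
  forall u : nat -> d.-tuple R -> R[i],
    (forall n, cLfun mu 1%:E (u n) /\ cLfun mu 2%:E (u n)) ->
    (cLnorm mu 2%:E (fun x => u n x - f x) @[n --> \oo] --> 0%E) ->
    (cLnorm mu 2%:E (fun w => fourierL1 (u n) w - g w) @[n --> \oo] --> 0%E).

(* By Plancherel's theorem every [f] in [L^2] has such a [g], unique up to a
   null set. One is chosen from the set of all of them; by [ae_eq_fourier] the
   choice depends only on the class of [f], so that a function of [fourier f]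
   is a function of the element [F[f]] of [L^2]. Outside [L^2] the value is
   meaningless. *)
Definition fourier f : d.-tuple R -> R[i] :=
  xget (fun=> 0) [set g | is_fourierL2 f g].

Lemma ae_eq_fourier f g : cLfun mu 2%:E f -> cLfun mu 2%:E g ->
  {ae mu, forall x, f x = g x} -> fourier f = fourier g.
Proof.
have main f1 f2 k : cmeasurable f1 -> cmeasurable f2 ->
    {ae mu, forall x, f1 x = f2 x} -> is_fourierL2 f1 k -> is_fourierL2 f2 k.
  move=> mf1 mf2 f12 [Lk f1k]; split=> // u Lu uf2; apply: f1k => //.
  rewrite (_ : (fun n => _) = fun n => cLnorm mu 2%:E (fun x => u n x - f2 x))//.
  apply/funext => n; have [[mu_n _] _] := Lu n.
  apply: ae_eq_cLnorm2; [exact: cmeasurableB|exact: cmeasurableB|].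
  by apply: filterS f12 => x ->.
move=> [mf _] [mg _] fg; rewrite /fourier; congr xget.
apply/seteqP; split=> k; apply: main => //.
by apply: filterS fg => x ->.
Qed.

End fourier.

Section matern.
Variables (R : realType) (d : nat).
Local Notation mu := (lebesgue_tuple R d).

Definition Gamma (s : R) : R :=
  \int[@lebesgue_measure R]_(t in `]0, +oo[) (t `^ (s - 1) * expR (- t)).

Definition matern_const (nu : R) : R :=
  2 ^+ d * pi `^ (d%:R / 2) * Gamma (nu + d%:R / 2) * (2 * nu) `^ nu / Gamma nu.

(* For [f] in [L^2], the squared norm of [f] in the reproducing kernel Hilbert
   space of the Matern kernel with smoothness [nu] and bandwidth [h] on [R^d];
   it is [+oo] when [f] is not in that space. *)
Definition matern_sqnorm (nu h : R) (f : d.-tuple R -> R[i]) : \bar R :=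
  ((h `^ (2 * nu) * ((2 * pi) `^ (d%:R / 2) * matern_const nu)^-1)%:E *
   \int[mu]_w ((2 * nu / h ^+ 2 + (2 * pi * enorm w) ^+ 2) `^ (nu + d%:R / 2) *
               cabs (fourier f w) ^+ 2)%:E)%E.

(* As a set this does not depend on [h]. *)
Definition matern_rkhs (nu h : R) : set (d.-tuple R -> R[i]) :=
  [set f | cLfun mu 2%:E f /\ (matern_sqnorm nu h f < +oo)%E].

End matern.

(* Main.v *)
Require Import Defs.
From HB Require Import structures.
From mathcomp Require Import all_boot all_order all_algebra complex.
From mathcomp Require Import all_classical all_reals all_analysis.
From mathcomp Require Import measurable_realfun lra.

Set Implicit Arguments.
Unset Strict Implicit.
Unset Printing Implicit Defensive.
Import Order.TTheory GRing.Theory Num.Theory.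
Import numFieldNormedType.Exports.

Local Open Scope classical_set_scope.
Local Open Scope ring_scope.

(** With [s = nu + d / 2], [a = 2 nu / h^2] and [b = (2 pi |w|)^2], the weight
   in the norm satisfies [(a + b)^s <= 2^s (a^s + b^s)]; here [b^s] is free of
   [h] and [a^s = (2 nu)^s / h^(2 nu + d)], so [C1] and [C2] are multiples of
   the integrals of [|F[f]|^2] and [b^s |F[f]|^2]. Both are finite because [a^s]
   and [b^s] are at most [(a + b)^s] and [a^s > 0]. *)

(** By symmetry one may take [a <= b]; then [a + b <= 2 * b], and monotonicity of the power gives
    the bound. No convexity enters, so [s < 1] needs no separate case. *)
Lemma powRD_le (R : realType) (a b s : R) : 0 <= a -> 0 <= b -> 0 <= s ->
  (a + b) `^ s <= 2 `^ s * (a `^ s + b `^ s).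
Proof.
wlog ab : a b / a <= b.
  move=> H a0 b0 s0; have [/H|/ltW/H] := leP a b; first exact.
  by rewrite addrC [b `^ s + _]addrC; exact.
move=> a0 b0 s0; apply: (@le_trans _ _ ((2 * b) `^ s)).
  by apply: ge0_ler_powR => //; rewrite ?nnegrE; lra.
by rewrite powRM// ler_wpM2l ?powR_ge0// lerDr powR_ge0.
Qed.

(** Strips constant factors from finite integrals. Strict positivity matters, since
    [0 * +oo = 0]. *)
Lemma pmule_lty_inv (R : realType) (r : R) (x : \bar R) : 0 < r ->
  (r%:E * x < +oo -> x < +oo)%E.
Proof. by move=> r0; case: x => [x _|/=|//]; rewrite ?ltry ?gt0_muley ?lte_fin. Qed.

Section weighted_integral.
Context dT (T : measurableType dT) (R : realType).
Variable mu : {measure set T -> \bar R}.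
Variables (a s : R) (b q : T -> R).
Hypotheses (a_gt0 : 0 < a) (s_ge0 : 0 <= s).
Hypotheses (b_ge0 : forall x, 0 <= b x) (q_ge0 : forall x, 0 <= q x).
Hypotheses (mb : measurable_fun setT b) (mq : measurable_fun setT q).

Let measurable_bq : measurable_fun setT (fun x => b x `^ s * q x).
Proof.
apply: measurable_funM => //.
by apply: (measurableT_comp (measurable_powR s)).
Qed.

Let measurable_abq : measurable_fun setT (fun x => (a + b x) `^ s * q x).
Proof.
apply: measurable_funM => //.
by apply: (measurableT_comp (measurable_powR s)); exact: measurable_funD.
Qed.

Local Open Scope ereal_scope.

(** Integrates [powRD_le] against [q]. All integrands are nonnegative, so linearity holds in
    [[0, +oo]] and no integrability is assumed. *)
Lemma integral_powRD_le :
  \int[mu]_x ((a + b x) `^ s * q x)%:E <=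
  (2 `^ s * a `^ s)%:E * \int[mu]_x (q x)%:E +
  (2 `^ s)%:E * \int[mu]_x (b x `^ s * q x)%:E.
Proof.
have mQ : measurable_fun setT (EFin \o q) by exact/measurable_EFinP.
have mB : measurable_fun setT (EFin \o (fun x => b x `^ s * q x)%R).
  exact/measurable_EFinP.
rewrite -!ge0_integralZl//; try by
  [move=> x _; rewrite lee_fin ?mulr_ge0 ?powR_ge0
  |rewrite lee_fin ?mulr_ge0 ?powR_ge0].
rewrite -ge0_integralD//; try by
  [move=> x _; rewrite -EFinM lee_fin !mulr_ge0 ?powR_ge0
  |exact: measurable_funeM].
apply: ge0_le_integral => //.
- by move=> x _; rewrite lee_fin mulr_ge0 ?powR_ge0.
- exact/measurable_EFinP.
- by apply: emeasurable_funD; exact: measurable_funeM.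
move=> x _; rewrite -!EFinM -EFinD lee_fin mulrA -mulrDl -mulrDr.
by rewrite ler_wpM2r// powRD_le// ltW.
Qed.

(** Ensures that passing to real values by [fine] loses nothing in the two integrals that define the
    constants. *)
Lemma integral_powRD_lty :
  \int[mu]_x ((a + b x) `^ s * q x)%:E < +oo ->
  \int[mu]_x (q x)%:E < +oo /\ \int[mu]_x (b x `^ s * q x)%:E < +oo.
Proof.
move=> fin; split; last first.
  apply: le_lt_trans fin; apply: ge0_le_integral => //.
  - by move=> x _; rewrite lee_fin mulr_ge0 ?powR_ge0.
  - exact/measurable_EFinP.
  - exact/measurable_EFinP.
  move=> x _; rewrite lee_fin ler_wpM2r// ge0_ler_powR ?nnegrE//.
    by rewrite addr_ge0// ltW.
  by rewrite lerDr ltW.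
have as0 : (0 < a `^ s)%R by rewrite powR_gt0.
have mQ : measurable_fun setT (EFin \o q) by exact/measurable_EFinP.
apply: (pmule_lty_inv as0).
rewrite -ge0_integralZl//; first last.
- by rewrite lee_fin ltW.
- by move=> x _; rewrite lee_fin.
apply: le_lt_trans fin; apply: ge0_le_integral => //.
- by move=> x _; rewrite -EFinM lee_fin mulr_ge0 ?powR_ge0.
- exact: measurable_funeM.
- exact/measurable_EFinP.
move=> x _; rewrite lee_fin ler_wpM2r// ge0_ler_powR ?nnegrE//.
- exact: ltW.
- by rewrite addr_ge0// ltW.
- by rewrite lerDl.
Qed.

End weighted_integral.

(** Holds for every [f]: a chosen representative lies in [L^2], and the default value of [xget] is
    the zero function. *)
Lemma cmeasurable_fourier (R : realType) d (f : d.-tuple R -> R[i]) :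
  cmeasurable (fourier f).
Proof.
rewrite /fourier; case: xgetP => [g _ [[]]//|_].
by split; exact: measurable_cst.
Qed.

Lemma measurable_enorm (R : realType) d : measurable_fun setT (@enorm R d).
Proof.
apply: (@measurableT_comp _ _ _ _ _ _ (@Num.sqrt R)).
  by apply: continuous_measurable_fun; exact: sqrt_continuous.
apply: measurable_sum => i.
by apply: measurable_funM; exact: measurable_tnth.
Qed.

Lemma Gamma_ge0 (R : realType) (s : R) : 0 <= Gamma s.
Proof.
by apply: Rintegral_ge0 => t _; rewrite mulr_ge0 ?powR_ge0 ?expR_ge0.
Qed.

Lemma matern_const_ge0 (R : realType) d (nu : R) : 0 <= matern_const d nu.
Proof.
by rewrite /matern_const !mulr_ge0 ?invr_ge0 ?powR_ge0 ?Gamma_ge0 ?exprn_ge0.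
Qed.

Theorem proposition2 (R : realType) (d : nat) (nu : R)
    (d_ge1 : (1 <= d)%N) (nu_gt0 : 0 < nu) :
  exists C1 C2 : (d.-tuple R -> R[i]) -> {nonneg R},
    forall (h : R) (f : d.-tuple R -> R[i]),
      0 < h -> matern_rkhs nu h f ->
      (matern_sqnorm nu h f <=
       (h `^ (2 * nu) *
        (1 / h `^ (2 * nu + d%:R) * (C1 (fourier f))%:num +
         (C2 (fourier f))%:num))%:E)%E.
Proof.
set mu := lebesgue_tuple R d.
pose s : R := nu + d%:R / 2.
pose c : R := ((2 * pi) `^ (d%:R / 2) * matern_const d nu)^-1.
pose b (w : d.-tuple R) : R := (2 * pi * enorm w) ^+ 2.
pose q (g : d.-tuple R -> R[i]) w : R := cabs (g w) ^+ 2.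
have s0 : 0 <= s by rewrite addr_ge0 ?divr_ge0// ltW.
have c0 : 0 <= c by rewrite invr_ge0 mulr_ge0 ?powR_ge0 ?matern_const_ge0.
have b0 w : 0 <= b w by exact: sqr_ge0.
have q0 g w : 0 <= q g w by exact: sqr_ge0.
have mb : measurable_fun setT b.
  by apply: measurable_funX; apply: measurable_funM => //; exact: measurable_enorm.
pose I1 g : \bar R := (\int[mu]_w (q g w)%:E)%E.
pose I2 g : \bar R := (\int[mu]_w (b w `^ s * q g w)%:E)%E.
have I1_ge0 g : (0 <= I1 g)%E by apply: integral_ge0 => w _; rewrite lee_fin.
have I2_ge0 g : (0 <= I2 g)%E.
  by apply: integral_ge0 => w _; rewrite lee_fin mulr_ge0 ?powR_ge0.
have C1_ge0 g : 0 <= c * (2 `^ s * (2 * nu) `^ s * fine (I1 g)).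
  by rewrite !mulr_ge0 ?powR_ge0 ?fine_ge0.
have C2_ge0 g : 0 <= c * (2 `^ s * fine (I2 g)).
  by rewrite !mulr_ge0 ?powR_ge0 ?fine_ge0.
exists (fun g => NngNum (C1_ge0 g)), (fun g => NngNum (C2_ge0 g)).
move=> h f h0 [_]; rewrite /matern_sqnorm -/c -/s /=.
set a := 2 * nu / h ^+ 2.
have a_gt0 : 0 < a by rewrite divr_gt0 ?mulr_gt0 ?exprn_gt0.
(* The power of [h] comes from [2 * s = 2 * nu + d]. *)
have aE : a `^ s = (2 * nu) `^ s / h `^ (2 * nu + d%:R).
  rewrite /a powRM ?invr_ge0 ?exprn_ge0 ?mulr_ge0 ?ltW//; congr (_ * _).
  rewrite -powR_inv1 ?exprn_ge0 ?ltW// -powR_mulrn ?ltW// -!powRrM -powRN.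
  by congr (_ `^ _); rewrite /s; lra.
have mq : measurable_fun setT (q (fourier f)).
  by apply: measurable_funX; exact/measurable_cabs/cmeasurable_fourier.
(* Knowing only [Gamma >= 0], we allow for the junk value [c = 0^-1 = 0], for
   which both sides vanish and no finiteness can be extracted. *)
have [->|c_neq0] := eqVneq c 0; first by rewrite !(mulr0, mul0r, addr0) mul0e.
have hc_gt0 : 0 < h `^ (2 * nu) * c.
  by rewrite mulr_gt0 ?powR_gt0// lt_neqAle eq_sym c_neq0.
(* Membership in the space now says that the weighted integral itself is finite. *)
move=> /(pmule_lty_inv hc_gt0) J_fin.
have [I1_fin I2_fin] := integral_powRD_lty a_gt0 s0 b0 (q0 _) mb mq J_fin.
have J_le := integral_powRD_le mu a_gt0 s0 b0 (q0 (fourier f)) mb mq.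
rewrite -/(I1 _) -/(I2 _) in J_le I1_fin I2_fin.
rewrite -[I1 _]fineK ?ge0_fin_numE// -[I2 _]fineK ?ge0_fin_numE// in J_le.
rewrite -!EFinM -EFinD in J_le.
apply: (le_trans (lee_wpmul2l _ J_le)); first by rewrite lee_fin ltW.
by rewrite -EFinM lee_fin aE; lra.
Qed.
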